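(* For every real $\alpha\ne0$, there are no rotational (spacelike) $K^\alpha$-translators with spacelike axis intersecting the rotation axis orthogonally.
   Context: $\mathbb R_1^3$ is $\mathbb R^3$ with the metric $\langle,\rangle=dx^2+dy^2-dz^2$. A surface is spacelike if its induced metric is Riemannian; then its unit normal $N$ satisfies $\langle N,N\rangle=\epsilon=-1$. The Gauss curvature is $K=\epsilon\det(A)$, where $AU=-\nabla^0_U N$ is the Weingarten map and $\nabla^0$ is the Levi-Civita connection of $\mathbb R_1^3$. In a local parametrization $X(u,v)$, $$K=-\frac{\det(X_u,X_v,X_{uu})\det(X_u,X_v,X_{vv})-\det(X_u,X_v,X_{uv})^2}{(EG-F^2)^2},$$ where $E=\langle X_u,X_u\rangle$, $F=\langle X_u,X_v\rangle$, $G=\langle X_v,X_v\rangle$. A spacelike surface is a $K^\alpha$-translator with speed $\vec v\in\mathbb R_1^3$ if $K>0$ and $K^\alpha=\langle N,\vec v\rangle$ everywhere, for a choice of unit normal $N$. A spacelike surface of revolution with spacelike axis is, after a rigid motion of $\mathbb R_1^3$, one whose axis is the $x$-axis, parametrized by $X(r,\theta)=(f(r),r\sinh\theta,r\cosh\theta)$ with $f$ smooth on an interval of $r>0$ and $f'^2>1$. The surface intersects the axis orthogonally if the generating curve $r\mapsto(f(r),0,r)$ is defined on an interval $(0,\delta)$ and $\lim_{r\to0}f'(r)=0$. *)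

(* Defs.v *)
From HB Require Import structures.
From mathcomp Require Import all_boot all_order all_algebra.
From mathcomp Require Import all_classical all_reals all_analysis.

Set Implicit Arguments.
Unset Strict Implicit.
Unset Printing Implicit Defensive.

Import Order.TTheory GRing.Theory Num.Theory.
Import numFieldNormedType.Exports.

Local Open Scope classical_set_scope.
Local Open Scope ring_scope.

Section Minkowski.
Variable R : realType.
Implicit Types (p q b : 'rV[R]_3).

Definition lorentz_product p q : R := p 0 0 * q 0 0 + p 0 1 * q 0 1 - p 0 2 * q 0 2.

(* Isometries of the Minkowski space; the linear part L acts on row vectors
   from the right.  No orientation is imposed. *)
Definition rigid_motion (T : 'rV[R]_3 -> 'rV[R]_3) : Prop :=
  exists (L : 'M[R]_3) b,
    (forall p q, lorentz_product (p *m L) (q *m L) = lorentz_product p q) /\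
    (forall p, T p = p *m L + b).

End Minkowski.

(* A parametrized surface is a map X : 'rV[R]_2 -> 'rV[R]_3 considered on an
   open domain D; its values outside D are irrelevant.  Tangent vectors at X p
   are the 'd X p U, for U : 'rV[R]_2. *)
Section Surface.
Variable R : realType.
Implicit Types (X N : 'rV[R]_2 -> 'rV[R]_3) (D : set 'rV[R]_2).
Implicit Types (p U : 'rV[R]_2) (A : 'M[R]_2) (K alpha : R).

Definition spacelike X D : Prop :=
  forall p, D p -> differentiable X p /\
    forall U, U != 0 -> 0 < lorentz_product ('d X p U) ('d X p U).

Definition unit_normal X D N : Prop :=
  forall p, D p ->
    [/\ differentiable N p,
        forall U, lorentz_product (N p) ('d X p U) = 0
      & lorentz_product (N p) (N p) = -1].

(* U *m A are the coordinates of the image of 'd X p U under the Weingarten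
   map; the Levi-Civita connection of the flat metric is the directional
   derivative, so that the covariant derivative of N along 'd X p U is
   'd N p U. *)
Definition weingarten X N p A : Prop :=
  forall U, 'd X p (U *m A) = - 'd N p U.

(* K = epsilon * det A, with epsilon = <N, N> *)
Definition gauss_curvature X N p K : Prop :=
  exists A, weingarten X N p A /\ K = lorentz_product (N p) (N p) * \det A.

Definition Kalpha_translator alpha (v : 'rV[R]_3) X D : Prop :=
  spacelike X D /\
  exists N, unit_normal X D N /\
    forall p, D p -> exists K,
      [/\ gauss_curvature X N p K, 0 < K & K `^ alpha = lorentz_product (N p) v].

End Surface.

Section Revolution.
Variable R : realType.
Implicit Types (f : R -> R) (I : set R).

Definition sinh (x : R) : R := (expR x - expR (- x)) / 2.
Definition cosh (x : R) : R := (expR x + expR (- x)) / 2.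

Definition smooth_on I f : Prop :=
  forall n r, I r -> derivable (derive1n n f) r 1.

Definition profile I f : Prop :=
  [/\ is_interval I, open I, I `<=` [set r | 0 < r] & smooth_on I f].

Definition revolution f (p : 'rV[R]_2) : 'rV[R]_3 :=
  let r := p 0 0 in let theta := p 0 1 in
  \row_(i < 3) [:: f r; r * sinh theta; r * cosh theta]`_i.

Definition revolution_dom I : set 'rV[R]_2 := [set p | I (p 0 0)].

(* X is a surface of revolution with spacelike axis, with generating curve
   (f r, 0, r), r in I, in coordinates where the axis is the x-axis.  It is
   spacelike if and only if f' ^ 2 > 1 on I. *)
Definition rotational I f (X : 'rV[R]_2 -> 'rV[R]_3) : Prop :=
  profile I f /\
  exists T, rigid_motion T /\
    forall p, revolution_dom I p -> X p = T (revolution f p).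

Definition meets_axis_orthogonally I f : Prop :=
  (exists2 delta : R, 0 < delta & [set r | 0 < r < delta] `<=` I) /\
  derive1 f r @[r --> 0^'+] --> (0 : R).

End Revolution.

(* Main.v *)
(** If [f' -> 0] at the axis then [f' ^ 2 < 1] there, whereas a spacelike
    surface of revolution has [f' ^ 2 > 1]: the tangent vector to a meridian
    has Lorentz square [f' ^ 2 - 1]. *)

Require Import Defs.
From mathcomp Require Import all_boot all_order all_algebra.
From mathcomp Require Import all_classical all_reals all_analysis.
From mathcomp Require Import ring.

Import Order.TTheory GRing.Theory Num.Theory.
Import numFieldNormedType.Exports.

Local Open Scope classical_set_scope.
Local Open Scope ring_scope.

(** The obstruction is causal. A meridian has velocity of Lorentz square [f'^2 - 1], a value that
    rigid motions preserve, so spacelikeness forces [f'^2 > 1] on all of [I]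
    ([spacelike_rotational_slope]). Orthogonality to the axis makes meridians timelike near it. *)

Lemma lorentz_productZ (R : realType) (a : R) (p : 'rV[R]_3) :
  lorentz_product (a *: p) (a *: p) = a ^+ 2 * lorentz_product p p.
Proof. by rewrite /lorentz_product !mxE; ring. Qed.

Lemma continuous_lorentz_square (R : realType) :
  continuous (fun p : 'rV[R]_3 => lorentz_product p p).
Proof.
move=> p.
have sqr i : ((q : 'rV[R]_3) 0 i * q 0 i) @[q --> p] --> p 0 i * p 0 i.
  have ci : ((q : 'rV[R]_3) 0 i) @[q --> p] --> p 0 i by exact: coord_continuous.
  exact: (cvgM ci ci).
exact: (cvgB (cvgD (sqr 0) (sqr 1)) (sqr 2)).
Qed.

(** At angle 0 the generating curve lies in the plane [y = 0], as [sinh 0 = 0] and [cosh 0 = 1]. *)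
Lemma revolution_meridianB {R : realType} (f : R -> R) (p q : 'rV[R]_2) :
  p 0 1 = 0 -> q 0 1 = 0 ->
  lorentz_product (revolution f p - revolution f q)
                  (revolution f p - revolution f q)
    = (f (p 0 0) - f (q 0 0)) ^+ 2 - (p 0 0 - q 0 0) ^+ 2.
Proof.
move=> p1 q1; rewrite /lorentz_product /revolution !mxE /= p1 q1.
by rewrite /sinh /cosh oppr0 subrr expR0 !mul0r !mulr0 subrr mulr0 addr0
  -(natrD _ 1 1) divff ?pnatr_eq0// !mulr1 !expr2.
Qed.

(** The Lorentz square of the velocity is computed as a limit over chords: an isometry acts on
    chords by its linear part alone, so neither [T] nor [revolution] has to be differentiated. *)
Lemma spacelike_rotational_slope {R : realType} {I : set R} {f : R -> R}
    {X : 'rV[R]_2 -> 'rV[R]_3} (r : R) :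
  rotational I f X -> spacelike X (revolution_dom I) -> I r ->
  1 < derive1 f r ^+ 2.
Proof.
move=> [[_ openI _ smoothf] [T [[L [b [Liso TE]]] XE]]] spX Ir.
(* [h *: U + p] runs along the meridian of angle 0 through the parameter [(r, 0)]. *)
pose p : 'rV[R]_2 := r *: delta_mx 0 0.
pose U : 'rV[R]_2 := delta_mx 0 0.
have pE h : (h *: U + p) 0 0 = h + r /\ (h *: U + p) 0 1 = 0.
  by rewrite !mxE /= !mulr1 !mulr0 addr0.
have p0 : p 0 0 = r by rewrite !mxE /= mulr1.
have p1 : p 0 1 = 0 by rewrite !mxE /= mulr0.
have domp : revolution_dom I p by rewrite /revolution_dom /= p0.
have [dX /(_ U)] := spX p domp.
have -> : U != 0 by apply/eqP => /matrixP/(_ 0 0)/eqP; rewrite !mxE oner_eq0.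
move=> /(_ isT); rewrite -deriveE//.
have dXU : h^-1 *: (X (h *: U + p) - X p) @[h --> 0^'] --> 'D_U X p.
  have dXpU : derivable X p U by exact: diff_derivable.
  exact: dXpU.
have lhs : lorentz_product (h^-1 *: (X (h *: U + p) - X p))
    (h^-1 *: (X (h *: U + p) - X p)) @[h --> 0^']
    --> lorentz_product ('D_U X p) ('D_U X p).
  exact: (continuous_cvg _ (@continuous_lorentz_square R ('D_U X p)) dXU).
have fr : h^-1 *: (f (h + r) - f r) @[h --> 0^'] --> derive1 f r.
  have df : derivable f r 1 := smoothf 0%N r Ir.
  rewrite derive1E.
  under eq_fun => h do rewrite -[X in f (X + r)]mulr1.
  exact: df.
have rhs : (h^-1 *: (f (h + r) - f r)) ^+ 2 - 1 @[h --> 0^']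
    --> derive1 f r ^+ 2 - 1.
  by apply: cvgB; [exact: cvgM|exact: cvg_cst].
suff <- : derive1 f r ^+ 2 - 1 = lorentz_product ('D_U X p) ('D_U X p).
  by rewrite subr_gt0.
apply: (cvg_unique _ rhs); first exact: Rhausdorff.
rewrite /=; apply: cvg_trans lhs; apply: near_eq_cvg.
have hr0 : h + r @[h --> 0^'] --> r.
  rewrite -[X in _ --> X]add0r; apply: cvg_within_filter.
  by apply: cvgD; [exact: cvg_id|exact: cvg_cst].
near=> h.
have h0 : h != 0 by near: h; exact: nbhs_dnbhs_neq.
(* [X] is known to be [T] after [revolution] only over [I]; openness keeps the chord's moving end
   there. *)
have Ihr : I (h + r) by near: h; apply: hr0; exact: open_nbhs_nbhs.
have [q0 q1] := pE h.
rewrite !XE//; last by rewrite /revolution_dom /= q0.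
(* The translation cancels in the chord and [L] preserves its Lorentz square. *)
rewrite !TE opprD addrACA subrr addr0 -mulmxBl scalemxAl Liso lorentz_productZ.
rewrite revolution_meridianB// q0 p0 addrK exprMn mulrBr -!exprMn mulVf//.
by rewrite expr1n.
Unshelve. all: by end_near. Qed.

Theorem corollary3p8 (R : realType) (alpha : R) (halpha : alpha != 0) :
  ~ exists (I : set R) (f : R -> R) (X : 'rV[R]_2 -> 'rV[R]_3) (v : 'rV[R]_3),
      [/\ rotational I f X,
          meets_axis_orthogonally I f
        & Kalpha_translator alpha v X (revolution_dom I)].
Proof.
move=> [I [f [X [v [rotX [[delta delta0 deltaI] f'0] [spX _]]]]]].
have : \forall r \near 0^'+, `|derive1 f r| < 1.
  (* The tolerance 1 is the slope of the light cone. *)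
  have /cvgrPdist_lt/(_ 1 ltr01) := f'0.
  by apply: filterS => r; rewrite sub0r normrN.
move=> f'lt1.
have [r /= [f'r r0 rdelta]] : exists r, [/\ `|derive1 f r| < 1, 0 < r & r < delta].
  near (0 : R)^'+ => r; exists r; split; near: r => //.
  - exact: nbhs_right_gt.
  - exact: nbhs_right_lt.
have Ir : I r by apply: deltaI; rewrite /= r0.
have := spacelike_rotational_slope _ rotX spX Ir.
by rewrite -real_normK ?num_real// ltNge expr_le1// ltW.
Unshelve. all: by end_near. Qed.
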